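(* Let $d\ge2$, let $a,b\in\mathbb{R}$ with $0<a<b$, and let $\varepsilon\in(0,1]$. Let $\mathcal{V}$ be the set of continuous functions $v:\mathbb{R}_+\to\mathbb{R}$ such that $a(y-x)\le v(y)-v(x)\le b(y-x)$ for all $x<y$ in $\mathbb R_+$. Let $\mathcal{U}$ be the set of functions $u:\mathbb{R}_+^d\to\mathbb{R}$ of the form $u(x_1,\dots,x_d)=\sum_{i=1}^d\delta_i v(x_i)$ with $v\in\mathcal{V}$ and $(\delta_1,\dots,\delta_d)\in[\varepsilon,1]^d$. Then the set of alternatives $X\equiv\mathbb{R}_+^d$, endowed with the Euclidean topology, is locally compact, separable and completely metrizable, and the class $\mathcal{P}$ of preferences induced by the utility functions in $\mathcal{U}$ is a closed set (in the closed convergence topology) of locally strict preferences.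
   Context: $\mathbb{R}_+=[0,\infty)$. The preference induced by $u:X\to\mathbb{R}$ is the relation $x\succeq y$ iff $u(x)\ge u(y)$. A preference on $X$ is a complete binary relation on $X$ that is closed as a subset of $X\times X$. $x\succ y$ means $x\succeq y$ and not $y\succeq x$. $\succeq$ is locally strict if for all $x\succeq y$ and every neighborhood $V$ of $(x,y)$ in $X\times X$ there is $(x',y')\in V$ with $x'\succ y'$. Closed convergence: $\succeq_n\to\succeq^*$ means (1) for all $x^*\succeq^* y^*$ there are $(x_n,y_n)\to(x^*,y^* )$ with $x_n\succeq_n y_n$ for all $n$; and (2) for every subsequence $\{\succeq_{n_k}\}_k$ and every limit $(x^*,y^* )$ of pairs with $x_{n_k}\succeq_{n_k}y_{n_k}$ for all $k$, $x^*\succeq^*y^*$. For locally compact, separable, completely metrizable $X$ this is convergence in the metrizable closed convergence topology on continuous binary relations (closed subsets of $X\times X$). *)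

(* Defs.v *)
From HB Require Import structures.
From mathcomp Require Import all_boot all_order all_algebra.
From mathcomp Require Import all_classical all_reals all_analysis.
Import Order.TTheory GRing.Theory Num.Theory.
Import numFieldNormedType.Exports.

Set Implicit Arguments.
Unset Strict Implicit.
Unset Printing Implicit Defensive.

Local Open Scope classical_set_scope.
Local Open Scope ring_scope.

Definition separable (T : topologicalType) : Prop :=
  exists2 D : set T, countable D & dense D.

Definition completely_metrizable (R : realType) (T : topologicalType) : Prop :=
  exists dist : T -> T -> R,
    [/\ forall x y, 0 <= dist x y,
        forall x y, dist x y = 0 <-> x = y,
        forall x y, dist x y = dist y x &
        forall x y z, dist x z <= dist x y + dist y z] /\
    (forall (x : T) (A : set T),
       nbhs x A <-> exists2 e, 0 < e & [set y | dist x y < e] `<=` A) /\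
    (forall s : nat -> T,
       (forall e, 0 < e -> exists N, forall m n,
          (N <= m)%N -> (N <= n)%N -> dist (s m) (s n) < e) ->
       exists l : T, s @ \oo --> l).

(* A binary relation is identified with its graph: the pair (x, y) belongs to F
   when x is weakly preferred to y. *)
Section Relations.
Variable X : topologicalType.
Implicit Type F : set (X * X).

Definition complete_rel F : Prop := forall x y, F (x, y) \/ F (y, x).

Definition preference F : Prop := complete_rel F /\ closed F.

Definition strict F (x y : X) : Prop := F (x, y) /\ ~ F (y, x).

Definition locally_strict F : Prop :=
  forall x y, F (x, y) -> forall V, nbhs (x, y) V ->
  exists x' y', V (x', y') /\ strict F x' y'.

Definition induced_preference (R : realType) (u : X -> R) : set (X * X) :=
  [set p | u p.1 >= u p.2].

Definition closed_convergence (Fn : nat -> set (X * X)) F : Prop :=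
  (forall p, F p ->
     exists2 s : nat -> X * X, (forall n, Fn n (s n)) & s @ \oo --> p) /\
  (forall k : nat -> nat, {homo k : m n / (m < n)%N} ->
   forall (s : nat -> X * X) p,
     (forall j, Fn (k j) (s j)) -> s @ \oo --> p -> F p).

End Relations.

Record closed_rel (X : topologicalType) : Type :=
  ClosedRel { rel_set :> set (X * X) ; closed_rel_set : closed rel_set }.

HB.instance Definition _ (X : topologicalType) := gen_eqMixin (closed_rel X).
HB.instance Definition _ (X : topologicalType) :=
  gen_choiceMixin (closed_rel X).

(* Closed convergence topology: the sets of closed relations missing a given
   compact set and those hitting a given open set form a subbase. When X is
   locally compact, separable and metrizable it is metrizable, and its convergent
   sequences of nonempty relations are those of [closed_convergence]. *)
Definition closed_convergence_subbase (X : topologicalType) :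
    set (set (closed_rel X)) :=
  [set [set F : closed_rel X | (F : set (X * X)) `&` K = set0] |
     K in [set K : set (X * X) | compact K]] `|`
  [set [set F : closed_rel X | (F : set (X * X)) `&` G !=set0] |
     G in [set G : set (X * X) | open G]].

HB.instance Definition _ (X : topologicalType) :=
  isSubBaseTopological.Build (closed_rel X)
    (@closed_convergence_subbase X) id.

Definition Rplus (R : realType) : set R := [set t | 0 <= t].
Arguments Rplus : clear implicits.

(* The matrix type carries the product topology of the subset topology of R_+,
   which is the Euclidean topology of R_+^d. *)
Notation orthant R d := ('rV[Rplus R]_d).

Section UtilityClasses.
Variables (R : realType) (d : nat).

Definition class_V (a b : R) : set (Rplus R -> R) :=
  [set v | continuous v /\
     forall x y : Rplus R, \val x < \val y ->
       a * (\val y - \val x) <= v y - v x <= b * (\val y - \val x)].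

Definition class_U (a b eps : R) : set (orthant R d -> R) :=
  [set u | exists (v : Rplus R -> R) (delta : 'I_d -> R),
     [/\ class_V a b v,
         forall i, eps <= delta i <= 1 &
         u = fun x : orthant R d => \sum_(i < d) delta i * v (x ord0 i)]].

Definition class_P (a b eps : R) : set (set (orthant R d * orthant R d)) :=
  [set induced_preference u | u in class_U a b eps].

End UtilityClasses.

Arguments class_U {R} d a b eps.
Arguments class_P {R} d a b eps.

(* Main.v *)
(* A preference in the class is induced by some u = sum_i delta_i v(x_i) with
   v(0) = 0, so that a t <= v(t) <= b t and u is b-Lipschitz for the l1 distance.
   Along an ultrafilter of such preferences the bounded numbers v(t) and delta_i
   therefore converge; the limits define a utility u* of the class, and u -> u*
   pointwise. Suppose the preferences converge to F in the closed convergence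
   sense. If F(x, y), the ultrafilter hits each neighbourhood of (x, y), and
   equicontinuity gives u*(x) >= u*(y). Conversely, if u*(x) >= u*(y), then local
   strictness gives (x', y') near (x, y) with u*(x') > u*(y'), hence
   u(x') > u(y') eventually, hence F(x', y'), and F(x, y) because F is closed.
   Closed sets and limits of sequences are handled by ultrafilters refining,
   respectively, the neighbourhood filter of F and the filter of cofinite sets.

   The retraction r |-> max(0, r) of R onto R_+ transfers compactness, density
   and completeness from R^d to the orthant. *)
Require Import Defs.
From mathcomp Require Import all_boot all_order all_algebra.
From mathcomp Require Import all_classical all_reals all_analysis.
From mathcomp Require Import lra.
Import Order.TTheory GRing.Theory Num.Theory.
Import numFieldNormedType.Exports.
Local Open Scope classical_set_scope.
Local Open Scope ring_scope.

(** * Entrywise convergence and continuity for matrices *)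

Section MatrixTopology.

(** A basic neighbourhood constrains finitely many entries, and a filter is stable under finite
    intersections. *)
Lemma cvg_mx {I : Type} {T : topologicalType} {m n : nat} (F : set_system I)
    {FF : Filter F} (f : I -> 'M[T]_(m, n)) (x : 'M[T]_(m, n)) :
  (forall i j, f t i j @[t --> F] --> x i j) -> f @ F --> x.
Proof.
move=> cf A [P nP PA].
have nearP : \forall t \near F, forall i j, P i j (f t i j).
  by apply: filter_forall => i; apply: filter_forall => j; exact: cf (nP i j).
by apply: filterS nearP => t; exact: PA.
Qed.

Lemma mx_coord_continuous {T : topologicalType} {m n : nat} i j :
  continuous (fun x : 'M[T]_(m, n) => x i j).
Proof.
move=> x A nA; exists (fun i' j' => if (i' == i) && (j' == j) then A else setT).
  move=> i' j'; case: ifPn => [/andP[/eqP -> /eqP ->] //|_].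
  exact: filterT.
by move=> y /(_ i j); rewrite !eqxx.
Qed.

Lemma map_mx_continuous {S T : topologicalType} {m n : nat} (f : S -> T) :
  continuous f -> continuous (fun x : 'M[S]_(m, n) => map_mx f x).
Proof.
move=> cf x; apply: (@cvg_mx _ _ _ _ (nbhs x)) => i j; rewrite mxE.
under eq_cvg => y do rewrite mxE.
apply: (@cvg_comp _ _ _ (fun y : 'M[S]_(m, n) => y i j) f).
  exact: mx_coord_continuous.
exact: cf.
Qed.

End MatrixTopology.

(** * Local compactness, separability and complete metrizability of the orthant *)

Section Orthant.
Context {R : realType}.
Implicit Types (r : R) (t : Rplus R).

Lemma pos_part_subproof r : Num.max 0 r \in Rplus R.
Proof. by rewrite inE /Rplus /= le_max lexx. Qed.

Definition pos_part r : Rplus R := exist _ (Num.max 0 r) (pos_part_subproof r).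

Lemma Rplus_ge0 t : 0 <= \val t.
Proof. by have := valP t; rewrite inE. Qed.

Lemma val_pos_part r : 0 <= r -> \val (pos_part r) = r.
Proof. by move=> r0; apply/max_idPr. Qed.

Lemma pos_partK t : pos_part (\val t) = t.
Proof. by apply: val_inj; rewrite val_pos_part // Rplus_ge0. Qed.

Lemma val_continuous : continuous (\val : Rplus R -> R).
Proof. exact: initial_continuous. Qed.

Lemma pos_part_continuous : continuous pos_part.
Proof.
apply: continuous_comp_initial => r.
apply: (@continuous_max R R (cst 0) id); [exact: cvg_cst|exact: cvg_id].
Qed.

Lemma val_coord_continuous {d} (i : 'I_d) :
  continuous (fun x : orthant R d => \val (x ord0 i)).
Proof.
move=> x; apply: continuous_comp; last exact: val_continuous.
exact: mx_coord_continuous.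
Qed.

Lemma map_pos_partK {d} (x : orthant R d) :
  map_mx pos_part (map_mx (\val : Rplus R -> R) x) = x.
Proof. by apply/matrixP => i j; rewrite !mxE pos_partK. Qed.

(** The neighbourhood [K] caps each coordinate at one more than that of [x]. It is compact as the
    image, under the entrywise retraction, of a product of segments in the full space. *)
Lemma orthant_locally_compact d : locally_compact [set: orthant R d].
Proof.
move=> x _.
pose box : set 'rV[R]_d :=
  [set y | forall i, `[0, \val (x ord0 i) + 1]%classic (y ord0 i)].
pose K : set (orthant R d) :=
  [set y | forall i, \val (y ord0 i) <= \val (x ord0 i) + 1].
have KE : K = [set map_mx pos_part y | y in box].
  apply/seteqP; split=> [y Ky|_ [z zbox <-] i].
    exists (map_mx \val y); last exact: map_pos_partK.
    by move=> i; rewrite /= mxE in_itv /= Rplus_ge0 Ky.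
  have := zbox i; rewrite /= in_itv /= mxE => /andP[z0 zx].
  by rewrite val_pos_part.
exists K; last split.
- suff : nbhs x K by apply: filterS => y Ky.
  apply: (@filter_forall _ _
    (fun i (y : orthant R d) => \val (y ord0 i) <= \val (x ord0 i) + 1)
    (nbhs x)) => i.
  by apply: cvgr_le (val_coord_continuous i x) _ _; rewrite ltrDl.
- rewrite KE; apply: continuous_compact.
    apply: continuous_subspaceT; apply: map_mx_continuous.
    exact: pos_part_continuous.
  apply: (@rV_compact _ _ (fun i => `[0, \val (x ord0 i) + 1]%classic)) => i.
  exact: segment_compact.
- have -> : K = \bigcap_i [set y : orthant R d |
                             \val (y ord0 i) <= \val (x ord0 i) + 1].
    by apply/seteqP; split=> y Ky i => [_|]; exact: Ky.
  apply: closed_bigI => i _.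
  apply: (@preimage_closed _ _ (fun y : orthant R d => \val (y ord0 i))
    [set r | r <= \val (x ord0 i) + 1]); last exact: closed_le.
  by move=> y _; exact: val_coord_continuous.
Qed.

(** The dense set consists of the rational vectors with negative entries replaced by 0. A
    neighbourhood in [Rplus R] pulls back along [pos_part] to a neighbourhood in the line, which
    contains a rational. *)
Lemma orthant_separable d : separable (orthant R d).
Proof.
exists (range (fun q : 'rV[rat]_d => map_mx (fun c => pos_part (ratr c)) q)).
  exact: sub_countable (card_image_le _ _) (countableP _).
move=> O [x Ox] oO.
have [P nP PO] : nbhs x O by exact: open_nbhs_nbhs.
have /choice[q qP] : forall i, exists q : rat, P ord0 i (pos_part (ratr q)).
  move=> i.
  have : nbhs (\val (x ord0 i)) (pos_part @^-1` P ord0 i).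
    apply: pos_part_continuous; rewrite pos_partK; exact: nP.
  rewrite nbhsE => -[B [oB Bx] BP].
  have [r [Br [q _ qr]]] := dense_rat (ex_intro _ _ Bx) oB.
  by exists q; apply: BP; rewrite qr.
exists (map_mx (fun c => pos_part (ratr c)) (\row_i q i)); split.
  by apply: PO => i j; rewrite !mxE (ord1 i); exact: qP.
by exists (\row_i q i).
Qed.

Definition l1dist {d} (x y : orthant R d) : R :=
  \sum_(i < d) `|\val (x ord0 i) - \val (y ord0 i)|.

Lemma l1dist_coord {d} (x y : orthant R d) i :
  `|\val (x ord0 i) - \val (y ord0 i)| <= l1dist x y.
Proof.
by rewrite /l1dist (bigD1 i) //= lerDl sumr_ge0.
Qed.

Lemma l1dist_eq0 {d} (x y : orthant R d) : l1dist x y = 0 <-> x = y.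
Proof.
split=> [xy0|->]; last by rewrite /l1dist big1 // => i _; rewrite subrr normr0.
apply/matrixP => i j; rewrite (ord1 i); apply: val_inj; apply/eqP.
by rewrite -subr_eq0 -normr_le0 -xy0 l1dist_coord.
Qed.

Lemma near_l1dist {d} (x : orthant R d) (e : R) :
  0 < e -> \forall y \near x, l1dist x y < e.
Proof.
move=> e0.
suff cd : continuous (l1dist x).
  by apply: cvgr_lt (cd x) _ _; rewrite (l1dist_eq0 x x).2.
apply: continuous_big => [|i _ y]; first exact: add_continuous.
apply: (@cvg_norm _ _ _ (nbhs y)); apply: cvgB; first exact: cvg_cst.
exact: val_coord_continuous.
Qed.

Lemma nbhs_l1dist {d} (x : orthant R d) (A : set (orthant R d)) :
  nbhs x A <-> exists2 e, 0 < e & [set y | l1dist x y < e] `<=` A.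
Proof.
split=> [[P nP PA]|[e e0 eA]]; last exact: filterS eA (near_l1dist x e e0).
(* Quantifying over all small [e] lets the radii of the finitely many coordinates be merged into
   one. *)
have : \forall e \near (0 : R)^'+, forall i (t : Rplus R),
    `|\val (x ord0 i) - \val t| < e -> P ord0 i t.
  apply: filter_forall => i.
  have : nbhs (\val (x ord0 i)) (pos_part @^-1` P ord0 i).
    apply: pos_part_continuous; rewrite pos_partK; exact: nP.
  case/nbhs_ballP => r /= r0 rP; near=> e => t te.
  rewrite -(pos_partK t); apply: rP; rewrite /ball /=.
  by apply: (lt_le_trans te); near: e; exact: nbhs_right_le.
move=> /(filterI (nbhs_right_gt 0)) /filter_ex[e [e0 eP]].
exists e => // y ye; apply: PA => i j; rewrite (ord1 i); apply: eP.
exact: le_lt_trans (l1dist_coord x y j) ye.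
Unshelve. all: by end_near. Qed.

Lemma orthant_completely_metrizable d : completely_metrizable R (orthant R d).
Proof.
exists l1dist; split; [split|split].
- by move=> x y; apply: sumr_ge0.
- exact: l1dist_eq0.
- by move=> x y; apply: eq_bigr => i _; rewrite distrC.
- move=> x y z; rewrite -big_split; apply: ler_sum => i _ /=.
  exact: ler_distD.
- exact: nbhs_l1dist.
move=> s cs.
have cvs i : cvg (\val (s n ord0 i) @[n --> \oo]).
  apply: R_complete; apply: cauchy_exP => e e0.
  have [N sN] := cs e e0.
  exists (\val (s N ord0 i)); exists N => // n /= Nn; rewrite /ball /=.
  by apply: le_lt_trans (l1dist_coord _ _ _) (sN _ _ _ _).
(* Applying [pos_part] to the real limits places them in [Rplus R] with no sign argument; since
   [pos_part] is continuous and fixes every [s n ord0 i], convergence carries over. *)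
exists (\row_i pos_part (lim (\val (s n ord0 i) @[n --> \oo]))).
apply: cvg_mx => i j; rewrite mxE (ord1 i).
rewrite (_ : (fun n => s n ord0 j) = pos_part \o (fun n => \val (s n ord0 j))).
  by apply: cvg_comp (cvs j) _; exact: pos_part_continuous.
by apply/funext => n /=; rewrite pos_partK.
Qed.

End Orthant.

(** * Additively separable utilities and their induced preferences *)

Section Utilities.
Context {R : realType}.
Implicit Types (a b eps : R) (v : Rplus R -> R).

(** Continuity is left out because the bounds imply it when [0 <= a] and [0 < b]. What remains
    consists of weak inequalities, which survive pointwise limits. *)
Definition slopes_within a b v := forall x y : Rplus R, \val x <= \val y ->
  a * (\val y - \val x) <= v y - v x <= b * (\val y - \val x).

Definition separable_utility {d} v (delta : 'I_d -> R) (x : orthant R d) : R :=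
  \sum_(i < d) delta i * v (x ord0 i).

(** The lower slope bound makes [v] nondecreasing, so the absolute value of an increment is the
    increment itself and the upper bound applies. *)
Lemma slopes_lipschitz a b v (x y : Rplus R) : 0 <= a -> slopes_within a b v ->
  `|v x - v y| <= b * `|\val x - \val y|.
Proof.
move=> a0 va; wlog xy : x y / \val x <= \val y => [th|].
  have [/th //|/ltW/th] := leP (\val x) (\val y).
  by rewrite distrC (distrC (\val y)).
have /andP[lo hi] := va x y xy.
have xy0 : 0 <= \val y - \val x by rewrite subr_ge0.
rewrite distrC (distrC (\val x)) (ger0_norm xy0) ger0_norm //.
by rewrite (le_trans _ lo)// mulr_ge0.
Qed.

Lemma slopes_continuous a b v : 0 <= a -> 0 < b -> slopes_within a b v ->
  continuous v.
Proof.
move=> a0 b0 va x; apply/(@cvgrPdist_le _ _ _ (nbhs x)) => e e0.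
have /(@cvgrPdist_le _ _ _ (nbhs x))/(_ (b^-1 * e)) := @val_continuous R x.
rewrite mulr_gt0 ?invr_gt0 // => /(_ isT); apply: filterS => y xy.
by apply: le_trans (slopes_lipschitz _ _ _ x y a0 va) _; rewrite -ler_pdivlMl.
Qed.

Lemma class_V_slopes a b v : 0 <= a -> 0 < b ->
  class_V a b v <-> slopes_within a b v.
Proof.
move=> a0 b0; split=> [[_ va] x y|va].
  rewrite le_eqVlt => /orP[/eqP/val_inj ->|/va //].
  by rewrite !subrr !mulr0 lexx.
split; first exact: slopes_continuous va.
by move=> x y /ltW; exact: va.
Qed.

Lemma separable_utility_continuous {d} a b v (delta : 'I_d -> R) :
  0 <= a -> 0 < b -> slopes_within a b v ->
  continuous (separable_utility v delta).
Proof.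
move=> a0 b0 va.
apply: continuous_big => [|i _ x]; first exact: add_continuous.
apply: (@cvgM _ _ (nbhs x)); first exact: cvg_cst.
apply: (@continuous_comp _ _ _ (fun x : orthant R d => x ord0 i) v).
  exact: mx_coord_continuous.
exact: slopes_continuous va _.
Qed.

Lemma separable_utility_lipschitz {d} a b v (delta : 'I_d -> R)
    (x y : orthant R d) :
  0 <= a -> 0 <= b -> slopes_within a b v -> (forall i, 0 <= delta i <= 1) ->
  `|separable_utility v delta x - separable_utility v delta y|
    <= b * l1dist x y.
Proof.
move=> a0 b0 va d01; rewrite -sumrB mulr_sumr.
apply: (le_trans (ler_norm_sum _ _ _)); apply: ler_sum => i _.
have /andP[di0 di1] := d01 i.
rewrite -mulrBr normrM (ger0_norm di0).
apply: le_trans (slopes_lipschitz _ _ _ _ _ a0 va).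
by rewrite ler_piMl.
Qed.

(** [pos_part] makes the shift total in [h]; for [h >= 0] it is plain addition of [h] to every
    coordinate. *)
Definition orthant_shift {d} (x : orthant R d) (h : R) : orthant R d :=
  map_mx (fun t => pos_part (\val t + h)) x.

Lemma cvg_orthant_shift {d} (x : orthant R d) :
  orthant_shift x h @[h --> 0^'+] --> x.
Proof.
apply: cvg_mx => i j.
have -> : (fun h => orthant_shift x h i j) =
    pos_part \o (fun h => \val (x i j) + h) by apply/funext => h; rewrite mxE.
have cadd : \val (x i j) + h @[h --> 0^'+] --> \val (x i j) + 0.
  by apply: cvgD; [exact: cvg_cst|exact: cvg_at_right_filter cvg_id].
rewrite addr0 in cadd.
apply: cvg_comp cadd _; rewrite -{2}(pos_partK (x i j)).
exact: pos_part_continuous.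
Qed.

(** The [i]-th summand grows by at least [delta i * a * h], which is positive; [0 < d] provides a
    summand. *)
Lemma separable_utility_shift {d} a b v (delta : 'I_d -> R)
    (x : orthant R d) (h : R) : (0 < d)%N ->
  0 < a -> slopes_within a b v -> (forall i, 0 < delta i) -> 0 < h ->
  separable_utility v delta x < separable_utility v delta (orthant_shift x h).
Proof.
move=> d0 a0 va dp h0; apply: ltr_sum.
  by apply/hasP; exists (Ordinal d0); rewrite ?mem_index_enum.
move=> i _; rewrite ltr_pM2l // mxE.
set y := pos_part _.
have yE : \val y = \val (x ord0 i) + h.
  by rewrite val_pos_part // addr_ge0 ?Rplus_ge0 // ltW.
have /andP[lo _] : a * (\val y - \val (x ord0 i)) <= v y - v (x ord0 i)
    <= b * (\val y - \val (x ord0 i)).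
  by apply: va; rewrite yE lerDl ltW.
rewrite -subr_gt0; apply: lt_le_trans lo.
by rewrite yE addrC addKr mulr_gt0.
Qed.

(** Raising all coordinates of [x] by a small [h] while keeping [y] fixed turns a weak preference
    into a strict one. *)
Lemma separable_utility_locally_strict {d} a b v (delta : 'I_d -> R) :
  (0 < d)%N -> 0 < a -> slopes_within a b v -> (forall i, 0 < delta i) ->
  locally_strict (induced_preference (separable_utility v delta)).
Proof.
move=> d0 a0 va dp x y xy V nV.
have cs : (orthant_shift x h, y) @[h --> 0^'+] --> (x, y).
  apply: (@cvg_pair _ _ _ _ (nbhs x) (nbhs y)); first exact: cvg_orthant_shift.
  exact: cvg_cst.
have /(filterI (nbhs_right_gt 0))/filter_ex[h [h0 Vh]] := cs _ nV.
exists (orthant_shift x h), y; split => //.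
have lt_shift := separable_utility_shift a b v delta x h d0 a0 va dp h0.
split; rewrite /induced_preference /=.
  exact: le_trans xy (ltW lt_shift).
by apply/negP; rewrite -ltNge; apply: le_lt_trans xy lt_shift.
Qed.

Lemma induced_preference_preference {X : topologicalType} (u : X -> R) :
  continuous u -> preference (induced_preference u).
Proof.
move=> cu; split.
  move=> x y; rewrite /induced_preference /=.
  by have [|/ltW] := leP (u y) (u x); [left|right].
rewrite (_ : induced_preference u =
  (fun p => u p.1 - u p.2) @^-1` [set r | 0 <= r]).
  apply: preimage_closed; last exact: closed_ge.
  move=> [x y] _; apply: (@cvgB _ _ _ (nbhs (x, y))).
    by apply: (@continuous_comp _ _ _ fst u); [exact: cvg_fst|exact: cu].
  by apply: (@continuous_comp _ _ _ snd u); [exact: cvg_snd|exact: cu].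
by apply/seteqP; split=> p /=; rewrite /induced_preference /= subr_ge0.
Qed.

(* Subtracting the constant [v 0] from [v] does not change the preference. *)
Lemma class_P_normalized {d} a b eps (F : set (orthant R d * orthant R d)) :
  0 <= a -> 0 < b ->
  class_P d a b eps F <-> exists vd : (Rplus R -> R) * ('I_d -> R),
    [/\ slopes_within a b vd.1, vd.1 (pos_part 0) = 0,
        forall i, eps <= vd.2 i <= 1 &
        F = induced_preference (separable_utility vd.1 vd.2)].
Proof.
move=> a0 b0; split.
  move=> [_ [v [delta [/(class_V_slopes a b v a0 b0) va deltaE ->]] <-]].
  pose c := v (pos_part 0).
  exists (fun t => v t - c, delta); split => //=; last 2 first.
  - by rewrite subrr.
  - have uE x : separable_utility (fun t => v t - c) delta x =
        separable_utility v delta x - \sum_i delta i * c.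
      by rewrite -sumrB; apply: eq_bigr => i _; rewrite mulrBr.
    by apply/seteqP; split=> p; rewrite /induced_preference /= !uE lerD2r.
  by move=> x y xy; rewrite opprB addrA subrK; exact: va.
move=> [[v delta] [/= va v0 deltaE ->]].
exists (separable_utility v delta) => //; exists v, delta; split => //.
exact/class_V_slopes.
Qed.

End Utilities.

(** * Limits along filters in the reals, and subbasic neighbourhoods of a closed relation *)

Lemma ultra_bounded_cvg {R : realType} {I : Type} (U : set_system I)
    {UU : UltraFilter U} (f : I -> R) (l r : R) :
  (\forall i \near U, l <= f i <= r) -> cvg (f i @[i --> U]).
Proof.
move=> lfr.
have [p [_ clp]] : `[l, r]%classic `&` cluster (f @ U) !=set0.
  apply: segment_compact; apply: filterS lfr => i.
  by rewrite /= in_itv.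
apply/cvg_ex; exists p => A nA.
(* The cluster point given by compactness is a limit: if the preimage of [A] were not in [U], its
   complement would be, and the complement of [A] would have to meet [A]. *)
have [//|UnA] := in_ultra_setVsetC (f @^-1` A) UU.
by have [q []] := clp (~` A) A UnA nA.
Qed.

Lemma lim_between {R : realType} {I : Type} (F : set_system I)
    {FF : ProperFilter F} (f : I -> R) (l r y : R) :
  (\forall i \near F, l <= f i <= r) -> f i @[i --> F] --> y -> l <= y <= r.
Proof.
move=> lfr fy.
have : y \in `[l, r]%R.
  apply: (closed_cvg (fun z => z \in `[l, r]%R) _ _ _ fy).
    exact: itv_closed.
  by apply: filterS lfr => i; rewrite in_itv.
by rewrite in_itv.
Qed.

Lemma subbase_open {Y : topologicalType} (A : set (closed_rel Y)) :
  closed_convergence_subbase A -> open A.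
Proof.
move=> sA; exists [set A] => [_ ->|]; last exact: bigcup_set1.
exact: (@finI_from1 _ _ (@closed_convergence_subbase Y) id A).
Qed.

Lemma near_miss_compact {Y : topologicalType} (F : closed_rel Y)
    (K : set (Y * Y)) : compact K -> rel_set F `&` K = set0 ->
  \forall H \near F, rel_set H `&` K = set0.
Proof.
move=> cK FK; apply: open_nbhs_nbhs; split => //.
by apply: subbase_open; left; exists K.
Qed.

Lemma near_hit_open {Y : topologicalType} (F : closed_rel Y)
    (G : set (Y * Y)) : open G -> rel_set F `&` G !=set0 ->
  \forall H \near F, rel_set H `&` G !=set0.
Proof.
move=> oG FG; apply: open_nbhs_nbhs; split => //.
by apply: subbase_open; right; exists G.
Qed.

(** * Closedness of the class, topological and sequential *)

Section Closedness.
Context {R : realType} {d : nat} (a b eps : R).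
Context (d_gt0 : (0 < d)%N) (a_gt0 : 0 < a) (b_gt0 : 0 < b).
Context (eps_gt0 : 0 < eps).
Notation X := (orthant R d).

Let a_ge0 : 0 <= a. Proof. exact: ltW. Qed.

(** Common core of both closedness results. The last two hypotheses are the traces of closed
    convergence along [U]: points of [F] are approximated by the [Fs i], and a pair lying in
    [U]-almost all [Fs i] lies in [F]. *)
Lemma class_P_ultralimit {I : Type} (U : set_system I) {UU : UltraFilter U}
    (Fs : I -> set (X * X)) (F : set (X * X)) :
  closed F ->
  (\forall i \near U, class_P d a b eps (Fs i)) ->
  (forall p V, F p -> nbhs p V ->
     \forall i \near U, exists2 q, V q & Fs i q) ->
  (forall p, (\forall i \near U, Fs i p) -> F p) ->
  class_P d a b eps F.
Proof.
move=> cF FsP F_hit F_lim.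
have /choice[vd vdP] : forall i, exists vd : (Rplus R -> R) * ('I_d -> R),
    class_P d a b eps (Fs i) ->
    [/\ slopes_within a b vd.1, vd.1 (pos_part 0) = 0,
        forall j, eps <= vd.2 j <= 1 &
        Fs i = induced_preference (separable_utility vd.1 vd.2)].
  move=> i; have [P|nP] := pselect (class_P d a b eps (Fs i)).
    by have [vd ?] := (class_P_normalized a b eps _ a_ge0 b_gt0).1 P; exists vd.
  (* Arbitrary value at indices outside the class; the set of these indices is negligible for
     [U]. *)
  by exists (fun=> 0, fun=> 0).
pose v i := (vd i).1; pose delta i := (vd i).2.
have {FsP vdP} good : \forall i \near U, [/\ slopes_within a b (v i),
    v i (pos_part 0) = 0, forall j, eps <= delta i j <= 1 &
    Fs i = induced_preference (separable_utility (v i) (delta i))].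
  by apply: filterS FsP => i; exact: vdP.
(* The normalization at 0 confines [v i t] to the segment from [a * t] to [b * t], independently of
   [i]. *)
have /choice[v' cv] : forall t, exists l : R, v i t @[i --> U] --> l.
  move=> t.
  apply/cvg_ex; apply: (@ultra_bounded_cvg _ _ U _ _ (a * \val t) (b * \val t)).
  apply: filterS good => i [/(_ (pos_part 0) t) + v0 _ _].
  by rewrite val_pos_part // v0 !subr0; apply; exact: Rplus_ge0.
have /choice[delta' cdelta] : forall j,
    exists l : R, delta i j @[i --> U] --> l.
  move=> j.
  apply/cvg_ex; apply: (@ultra_bounded_cvg _ _ U _ _ eps 1).
  by apply: filterS good => i [_ _ + _]; exact.
have slopes' : slopes_within a b v'.
  move=> x y xy; apply: (@lim_between _ _ U _ (fun i => v i y - v i x)).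
    by apply: filterS good => i [+ _ _ _]; exact.
  exact: cvgB (cv y) (cv x).
have delta'E j : eps <= delta' j <= 1.
  by apply: lim_between (cdelta j); apply: filterS good => i [_ _ + _]; exact.
pose u i : X -> R := separable_utility (v i) (delta i).
pose u' : X -> R := separable_utility v' delta'.
have cu x : u i x @[i --> U] --> u' x.
  apply: cvg_big => [|j _]; first exact: add_continuous.
  by apply: cvgM; [exact: cdelta|exact: cv].
have uE : \forall i \near U, Fs i = induced_preference (u i).
  by apply: filterS good => i [].
have u_lip : \forall i \near U, forall x y, `|u i x - u i y| <= b * l1dist x y.
  apply: filterS good => i [vi _ di _] x y.
  apply: (separable_utility_lipschitz a) => //; first exact: ltW.
  by move=> j; have /andP[ej ->] := di j; rewrite (le_trans (ltW eps_gt0) ej).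
suff -> : F = induced_preference u'.
  by exists u' => //; exists v', delta'; split => //; exact/class_V_slopes.
apply/seteqP; split=> [[x y] Fxy|[x y] uxy].
  rewrite /induced_preference /= leNgt; apply/negP => uxy.
  (* Four errors below [e] arise: two from moving to the nearby pair [(x1, y1)], two from replacing
     [u i] by [u']. Together they stay below the gap [u' y - u' x], contradicting
     [u i y1 <= u i x1]. *)
  pose e := (u' y - u' x) / 4.
  have e0 : 0 < e by rewrite /e; lra.
  have be0 : 0 < b^-1 * e by rewrite mulr_gt0 // invr_gt0.
  have nV : nbhs (x, y) [set q : X * X |
      l1dist x q.1 < b^-1 * e /\ l1dist y q.2 < b^-1 * e].
    exists ([set x1 | l1dist x x1 < b^-1 * e],
            [set y1 | l1dist y y1 < b^-1 * e]).
      by split; exact: near_l1dist.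
    by case.
  have hit := F_hit _ _ Fxy nV.
  near U => i.
  have [[x1 y1] /= [xx1 yy1]] : exists2 q : X * X,
      l1dist x q.1 < b^-1 * e /\ l1dist y q.2 < b^-1 * e & Fs i q.
    by near: i.
  have -> : Fs i = induced_preference (u i) by near: i.
  rewrite /induced_preference /= => u1.
  have lip : forall x y, `|u i x - u i y| <= b * l1dist x y by near: i.
  have lx : `|u i x - u i x1| < e.
    by apply: le_lt_trans (lip _ _) _; rewrite -ltr_pdivlMl.
  have ly : `|u i y - u i y1| < e.
    by apply: le_lt_trans (lip _ _) _; rewrite -ltr_pdivlMl.
  have xi : u i x < u' x + e.
    by near: i; apply: cvgr_lt (cu x) _ _; rewrite ltrDl.
  have yi : u' y - e < u i y.
    by near: i; apply: cvgr_gt (cu y) _ _; rewrite gtrBl.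
  move: lx ly; rewrite !ltr_norml /e => /andP[? ?] /andP[? ?].
  by move: xi yi; rewrite /e; lra.
(* As [F] is closed, a point of [F] in each neighbourhood of [(x, y)] suffices; a strict pair for
   [u'] is one, since strictness persists for [u i] along [U]. *)
apply: cF => V nV.
have [x' [y' [Vxy [uxy' nuxy']]]] : exists x' y', V (x', y') /\
    strict (induced_preference u') x' y'.
  apply: (separable_utility_locally_strict a b v') uxy _ nV => //.
  by move=> j; have /andP[+ _] := delta'E j; exact: lt_le_trans.
exists (x', y'); split => //; apply: F_lim.
have lt_u : 0 < u' x' - u' y'.
  by rewrite subr_gt0 ltNge; apply/negP.
have ui : \forall i \near U, 0 < u i x' - u i y'.
  exact: cvgr_gt _ (cvgB (cu x') (cu y')) _ lt_u.
by apply: filterS (filterI uE ui) => i [-> /=]; rewrite subr_gt0; exact: ltW.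
Unshelve. all: by end_near. Qed.

Lemma class_P_closed :
  closed [set F : closed_rel X | class_P d a b eps F].
Proof.
move=> F clF.
(* As [F] is in the closure, its neighbourhoods have proper traces on the class; [U] refines these,
   so it contains the class as well. *)
have [U [UU sU]] := ultraFilterLemma (within_nbhs_proper clF).
have FU : forall A, nbhs F A -> U A.
  by move=> A nA; apply: sU; apply: filterS nA.
apply: (@class_P_ultralimit _ U UU (fun G : closed_rel X => G : set _)).
- exact: closed_rel_set.
- by apply: sU; exact: nearW.
- move=> p V Fp; rewrite nbhsE => -[V' [oV' V'p] V'V].
  have := near_hit_open F V' oV' (ex_intro _ p (conj Fp V'p)).
  by move=> /FU; apply: filterS => G [q [Gq /V'V Vq]]; exists q.
- move=> p Up; apply: contrapT => nFp.
  (* The singleton of [p] is compact, so a closed [F] avoiding it has a neighbourhood of relations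
     avoiding [p], against [Up]. *)
  have : (F : set (X * X)) `&` [set p] = set0.
    by apply/seteqP; split=> // q [Fq qp]; rewrite qp in Fq.
  move=> /(near_miss_compact _ _ (@compact_set1 _ p))/FU/(filterI Up).
  by move=> /filter_ex[G [Gp GE]]; suff : set0 p by []; rewrite -GE.
Qed.

Lemma class_P_seq_closed (Fn : nat -> closed_rel X) (F : closed_rel X) :
  (forall n, class_P d a b eps (Fn n)) -> closed_convergence Fn F ->
  class_P d a b eps F.
Proof.
move=> FnP [F_inf F_sup].
have [U [UU sU]] := ultraFilterLemma eventually_filter.
apply: (@class_P_ultralimit _ U UU (fun n => Fn n : set _)).
- exact: closed_rel_set.
- exact: nearW.
- move=> p V Fp nV; have [s sFn sp] := F_inf p Fp.
  have sV : \forall n \near \oo, V (s n) by exact: sp.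
  by apply: sU; apply: filterS sV => n Vs; exists (s n).
- move=> p Up.
  (* [U] contains every tail, so [p] belongs to [Fn n] for arbitrarily large [n]. *)
  have /choice[f fP] : forall N, exists n, (N <= n)%N /\ rel_set (Fn n) p.
    move=> N; have NU : U [set n | (N <= n)%N].
      by apply: sU; exact: nbhs_infty_ge.
    by have [n []] := filter_ex (filterI NU Up); exists n.
  (* Applying [f] to the successor of the previous index makes [k] strictly increasing. The limsup
     clause is then used on this subsequence with the constant sequence [p]. *)
  pose k := fix k n := if n is m.+1 then f (k m).+1 else f 0%N.
  apply: (F_sup k _ (fun=> p)) => //; last exact: cvg_cst.
    apply: homo_ltn => [|n /=]; first exact: ltn_trans.
    by have [] := fP (k n).+1.
  by case=> [|n] /=; [have [] := fP 0%N|have [] := fP (k n).+1].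
Qed.

End Closedness.

Theorem corollary2 (R : realType) (d : nat) (a b eps : R) :
  (2 <= d)%N -> 0 < a -> a < b -> 0 < eps -> eps <= 1 ->
  [/\ locally_compact [set: orthant R d],
      separable (orthant R d) &
      completely_metrizable R (orthant R d)] /\
  [/\ forall F : set (orthant R d * orthant R d),
        class_P d a b eps F -> preference F /\ locally_strict F,
      closed [set F : closed_rel (orthant R d) | class_P d a b eps F] &
      forall (Fn : nat -> closed_rel (orthant R d))
             (F : closed_rel (orthant R d)),
        (forall n, class_P d a b eps (Fn n)) -> closed_convergence Fn F ->
        class_P d a b eps F].
Proof.
move=> d2 a0 ab e0 e1; have d0 : (0 < d)%N := ltnW d2.
have b0 : 0 < b := lt_trans a0 ab.
split; split.
- exact: orthant_locally_compact.
- exact: orthant_separable.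
- exact: orthant_completely_metrizable.
- move=> F /(class_P_normalized a b eps F (ltW a0) b0).
  move=> [[v delta] [/= va _ deltaE ->]]; split.
    apply: induced_preference_preference.
    exact: (separable_utility_continuous a b) (ltW a0) b0 va.
  apply: (separable_utility_locally_strict a b) => // i.
  by have /andP[+ _] := deltaE i; exact: lt_le_trans.
- exact: class_P_closed.
- by move=> Fn F; exact: class_P_seq_closed.
Qed.
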